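(* In the setting described in the context, suppose that the channel transition matrix $Q$ is stochastically monotone and that $\mathbb U$ is a finite set $\mathbb U=\{0,u^{(1)},\dots,u^{(m)}\}$ (with $u^{(0)}=0$). For any $i\in\{0,1,\dots,m\}$ define $$k^{(i)}_t(s)=\inf\{e\in\mathbb R_{\ge0}:\tilde f_t(e,s)=u^{(i)}\},$$ and define $k^{(m+1)}_t(s)=\infty$. (Note that $k^{(0)}_t(s)=0$ and, since $\tilde f_t(\cdot,s)$ is even and quasi-convex, $k^{(i)}_t(s)\le k^{(i+1)}_t(s)$ for any $i\in\{0,1,\dots,m\}$.) Then the optimal strategy is a threshold-based strategy: for any $s\in\mathbb S$, $i\in\{0,\dots,m\}$ and $|e|\in\big[k^{(i)}_t(s),k^{(i+1)}_t(s)\big)$, $$\tilde f_t(e,s)=u^{(i)}.$$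
   Context: $\mathbb X$ is $\mathbb Z$ or $\mathbb R$; $a\in\mathbb X$; $\{W_t\}$ is an i.i.d. $\mathbb X$-valued sequence with symmetric and unimodal distribution $\mu$ (pdf if $\mathbb X=\mathbb R$, pmf if $\mathbb X=\mathbb Z$). $\mathbb S=\{1,\dots,n\}$ is the ordered set of channel states (larger = better) with transition matrix $Q$; $Q$ is stochastically monotone if for all $i,j\in\{1,\dots,n\}$ with $i>j$ and any $\ell\in\{0,\dots,n-1\}$, $\sum_{k=\ell+1}^nQ_{ik}\ge\sum_{k=\ell+1}^nQ_{jk}$. $\mathbb U\subset\mathbb R_{\ge0}$ is the set of power levels, listed in increasing order $0<u^{(1)}<\dots<u^{(m)}$. The packet-drop probability $p(s,u)$ is weakly decreasing in $u$ and decreasing in $s$, with $p(s,0)=1$. The transmission cost $\lambda$ is weakly increasing with $\lambda(0)=0$ and finite at the maximum power; the distortion $d$ is even and quasi-convex with $d(0)=0$. The error process $E_t$ of the remote estimation problem evolves as follows: given $E_t=e$, $S_{t-1}=s$ and power $U_t=u$, the channel state is $S_t=s'$ with probability $Q_{ss'}$; then $E_{t+1}=ae+W_t$ with probability $p(s',u)$ (packet dropped) and $E_{t+1}=W_t$ with probability $1-p(s',u)$ (packet received). Value functions: $J_{T+1}(e,s)=0$ and, for $t\in\{T,\dots,0\}$, $$J_t(e,s)=\min_{u\in\mathbb U}\Big\{\lambda(u)+\sum_{s'\in\mathbb S}Q_{ss'}p(s',u)d(e)+\mathbb E[J_{t+1}(E_{t+1},S_t)\mid E_t=e,S_{t-1}=s,U_t=u]\Big\}.$$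 $\tilde f_t(e,s)$ denotes the arg min; $U_t=\tilde f_t(E_t,S_{t-1})$ is an optimal transmission strategy for the finite-horizon problem and, under stochastic monotonicity of $Q$, it is even and quasi-convex in $e$ for every $s$.
   Formalization: Ties in the arg min go to the largest power; the threshold of a power level that is never used is the next level's threshold; for real-valued errors the claim at |e| = k^(i) is asserted only if d is right-continuous on [0,∞) and the expectations in the recursion are finite. *)

(* Defs.v *)
From HB Require Import structures.
From mathcomp Require Import all_boot all_order all_algebra.
From mathcomp Require Import all_classical all_reals all_analysis.
Set Implicit Arguments.
Unset Strict Implicit.
Unset Printing Implicit Defensive.
Import Order.TTheory GRing.Theory Num.Theory.
Import numFieldNormedType.Exports.
Local Open Scope classical_set_scope.
Local Open Scope ring_scope.

(* The error process is either integer-valued or real-valued. *)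
Variant alphabet := Integers | Reals.

Definition carrier (R : realType) (X : alphabet) : realDomainType :=
  match X with Integers => int | Reals => R end.

Definition to_real (R : realType) (X : alphabet) : carrier R X -> R :=
  match X with Integers => fun z : int => z%:~R | Reals => fun r : R => r end.

(* E[g(W)] for W with pmf (resp. pdf) mu.  Values are in \bar R because the
   distortion may be unbounded; only nonnegative g are ever used. *)
Definition noise_mean (R : realType) (X : alphabet) :
    (carrier R X -> R) -> (carrier R X -> \bar R) -> \bar R :=
  match X with
  | Integers => fun (mu : int -> R) (g : int -> \bar R) =>
      (\esum_(w in [set: int]) ((mu w)%:E * g w))%E
  | Reals => fun (mu : R -> R) (g : R -> \bar R) =>
      (\int[@lebesgue_measure R]_w ((mu w)%:E * g w))%E
  end.

Section Shape.
Context (R : realType) (X : alphabet).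
Implicit Types (mu d : carrier R X -> R).

Definition even_fun d := forall e, d (- e) = d e.

(* On Z and on R the points of a segment are exactly the intermediate ones. *)
Definition quasiconvex d :=
  forall x y z, x <= y -> y <= z -> d y <= Num.max (d x) (d z).

Definition unimodal mu :=
  exists c, (forall x y, x <= y -> y <= c -> mu x <= mu y) /\
            (forall x y, c <= x -> x <= y -> mu y <= mu x).

(* Measurability of a density is not listed: unimodality implies it. *)
Definition is_distribution mu :=
  (forall w, 0 <= mu w) /\ noise_mean mu (fun=> 1%E) = 1%E.

End Shape.

Definition right_continuous_nneg (R : realType) (X : alphabet) :
    (carrier R X -> R) -> Prop :=
  match X with
  | Integers => fun _ => True
  | Reals => fun d : R -> R =>
      forall e : R, 0 <= e -> d y @[y --> e^'+] --> d e
  end.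

Definition transition_matrix (R : realType) (n : nat) (Q : 'M[R]_n) :=
  (forall i j, 0 <= Q i j) /\ (forall i, \sum_j Q i j = 1).

(* States are 0, ..., n - 1 instead of 1, ..., n, so that the tail sum over
   k = l + 1, ..., n becomes the sum over the ordinals k >= l. *)
Definition stochastically_monotone (R : realType) (n : nat) (Q : 'M[R]_n) :=
  forall i j l : 'I_n, (j < i)%N ->
    \sum_(k < n | (l <= k)%N) Q j k <= \sum_(k < n | (l <= k)%N) Q i k.

Section Model.
Context (R : realType) (X : alphabet).
Context (a : carrier R X) (mu : carrier R X -> R).
Context (n : nat) (Q : 'M[R]_n).
(* The power levels are u 0 < u 1 < ... < u m; u is irrelevant beyond m. *)
Context (m : nat) (u : nat -> R).
Context (p : 'I_n -> R -> R) (lam : R -> R) (d : carrier R X -> R).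
Context (T : nat).

Local Open Scope ereal_scope.

(* The expression minimized in the dynamic program, with continuation value V:
   e is the current error, s the previous channel state, v the power. *)
Definition stage_cost (V : carrier R X -> 'I_n -> \bar R)
    (e : carrier R X) (s : 'I_n) (v : R) : \bar R :=
  (lam v)%:E
  + ((\sum_(s' < n) Q s s' * p s' v) * d e)%R%:E
  + \sum_(s' < n) (Q s s')%:E *
      ((p s' v)%:E * noise_mean mu (fun w => V (a * e + w)%R s')
       + (1 - p s' v)%R%:E * noise_mean mu (fun w => V w s')).

Fixpoint cost_to_go (k : nat) (e : carrier R X) (s : 'I_n) : \bar R :=
  if k is k'.+1 then
    \big[mine/+oo]_(i < m.+1) stage_cost (cost_to_go k') e s (u i)
  else 0.

Definition J (t : nat) := cost_to_go (T.+1 - t).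

(* The arg min; ties are resolved in favour of the largest power, the choice
   consistent with thresholds that are closed on the left. *)
Definition opt_power (t : nat) (e : carrier R X) (s : 'I_n) : R :=
  \big[Num.max/0%R]_(i < m.+1 | stage_cost (J t.+1) e s (u i) == J t e s) u i.

Definition level_set (t : nat) (s : 'I_n) (i : nat) : set (\bar R) :=
  [set (to_real e)%:E | e in [set e | (0 <= e)%R /\ opt_power t e s = u i]].

(* The infimum of the level set of u i.  For a power level that is never used,
   the infimum over the empty set is read as the next threshold, so that
   thresholds are ordered and the interval of an unused level is empty. *)
Fixpoint threshold_from (t : nat) (s : 'I_n) (r i : nat) : \bar R :=
  if r is r'.+1 then
    if `[< level_set t s i !=set0 >] then ereal_inf (level_set t s i)
    else threshold_from t s r' i.+1
  else +oo.

Definition threshold (t : nat) (s : 'I_n) (i : nat) : \bar R :=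
  threshold_from t s (m.+1 - i) i.

(* Ensures that thresholds are attained.  Over the reals they need not be
   otherwise: with d e = 1 for e <> 0 and d 0 = 0, a cheap reliable level is
   used at every e <> 0 but not at its threshold 0. *)
Definition boundary_regular :=
  X = Integers \/
  (right_continuous_nneg d /\
   forall t e s, (t <= T)%N ->
     noise_mean mu (fun w => J t.+1 (a * e + w)%R s) < +oo).

End Model.

(* Main.v *)
(* Since mu is even and unimodal, J_t(e, s) is nondecreasing in |e|: averaging the
   mean at y with its image under the reflection exchanging x and y reduces
   E V(x + W) <= E V(y + W), for |x| <= |y|, to a two-term rearrangement
   inequality.  Using a higher power lowers the weight of the part of the stage
   cost growing with |e|, so the stage cost is submodular in (|e|, u) and the
   largest minimizing power is nondecreasing in |e|.  Each threshold is then the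
   infimum of the nonnegative e at which that power or a higher one is used.  Over
   the reals the infimum is attained because the mean of a monotone function
   against a density is continuous, by dominated convergence off the countably
   many discontinuities. *)
From HB Require Import structures.
Require Import Defs.
From mathcomp Require Import all_boot all_order all_algebra.
From mathcomp Require Import all_classical all_reals all_analysis measurable_realfun.
From mathcomp Require Import ring lra zify.
Set Implicit Arguments.
Unset Strict Implicit.
Unset Printing Implicit Defensive.
Import Order.TTheory GRing.Theory Num.Theory.
Import numFieldNormedType.Exports.
Local Open Scope classical_set_scope.
Local Open Scope ring_scope.

(** * Functions monotone in the absolute value, and rearrangement under a reflection *)

Definition radial {A : realDomainType} {d} {B : porderType d} (V : A -> B) :=
  forall x y, `|x| <= `|y| -> (V x <= V y)%O.

Lemma ler_norm_sqr (A : realDomainType) (x y : A) :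
  (`|x| <= `|y|) = (x ^+ 2 <= y ^+ 2).
Proof.
by rewrite -(real_normK (num_real x)) -(real_normK (num_real y)) ler_sqr ?nnegrE.
Qed.

(** Both differences of squares contain the factor [w *+ 2 - (x + y)]. The cofactors [y - x] and
    [x + y] have a nonnegative product because [x ^+ 2 <= y ^+ 2], so the two differences cannot
    have strictly opposite signs. *)
Lemma reflection_dichotomy (A : realDomainType) (x y w : A) :
  `|x| <= `|y| ->
  (`|w - y| <= `|w - x| /\ `|x + y - w| <= `|w|) \/
  (`|w - x| <= `|w - y| /\ `|w| <= `|x + y - w|).
Proof.
rewrite !ler_norm_sqr => xy.
have dist_cmp : (w - x) ^+ 2 - (w - y) ^+ 2 = (y - x) * (w *+ 2 - (x + y)).
  by rewrite -mulr_natl; ring.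
have norm_cmp : w ^+ 2 - (x + y - w) ^+ 2 = (x + y) * (w *+ 2 - (x + y)).
  by rewrite -mulr_natl; ring.
have : 0 <= (y - x) * (x + y) by lra.
move: (y - x) (x + y) (w *+ 2 - (x + y)) dist_cmp norm_cmp => D S Z eD eS DS.
have [DZ|DZ] := leP 0 (D * Z); have [SZ|SZ] := leP 0 (S * Z).
- by left; lra.
- have [DZ0|DZ0] := eqVneq (D * Z) 0; first by right; lra.
  have : (D * Z) * (S * Z) < 0 by rewrite pmulr_rlt0// lt0r DZ0.
  by rewrite mulrACA ltNge mulr_ge0// -expr2 sqr_ge0.
- have [SZ0|SZ0] := eqVneq (S * Z) 0; first by right; lra.
  have : (D * Z) * (S * Z) < 0 by rewrite nmulr_rlt0// lt0r SZ0.
  by rewrite mulrACA ltNge mulr_ge0// -expr2 sqr_ge0.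
- by right; lra.
Qed.

(** Splitting [c] as [(c - b) + b] reduces the claim to [(c - b) * B <= (c - b) * A], without
    subtracting the possibly infinite [A] and [B]. *)
Lemma rearrangement {R : realType} (b c : R) (A B : \bar R) :
  0 <= b <= c -> (0 <= B <= A)%E ->
  (b%:E * A + c%:E * B <= c%:E * A + b%:E * B)%E.
Proof.
move=> /andP[b0 bc] /andP[B0 BA].
have A0 := le_trans B0 BA.
have cb0 : 0 <= c - b by rewrite subr_ge0.
rewrite -(subrK b c) EFinD !ge0_muleDl ?lee_fin//.
by rewrite addeCA -addeA leeD// lee_wpmul2l// lee_fin.
Qed.

(** The given mode [c] may differ from 0. If [c <= |x|], the decreasing branch applies to [|x|] and
    [|y|]; otherwise [c] is positive and the increasing branch applies to [-|y|] and [-|x|]. *)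
Lemma unimodal_even_radial {R : realType} {X : alphabet} (mu : carrier R X -> R) :
  even_fun mu -> unimodal mu -> radial (fun w => - mu w).
Proof.
move=> mu_even [c [mu_up mu_down]] x y.
have mu_norm z : mu z = mu `|z|.
  by have [z0|z0] := leP 0 z; [rewrite ger0_norm|rewrite ltr0_norm].
rewrite lerN2 (mu_norm x) (mu_norm y) => xy.
have [cx|xc] := leP c `|x|; first exact: mu_down.
rewrite -mu_even -(mu_even `|x|); apply: mu_up; first by rewrite lerN2.
by rewrite (le_trans _ (ltW xc))// (le_trans _ (normr_ge0 _))// oppr_le0.
Qed.

(** * Measurability, and invariance of sums and integrals under reflection *)

Lemma measurable_radial {R : realType} (V : R -> \bar R) :
  radial V -> measurable_fun [set: measurableTypeR R] V.
Proof.
move=> V_radial _; apply: (measurability _ (ErealGenInftyO.measurableE R)) => //.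
move=> _ [_ [r ->] <-]; rewrite setTI preimage_itvNyo.
(* A point between [x] and [y] has absolute value at most that of one of them, so strict sublevel
   sets are intervals. *)
apply: is_interval_measurable => x y /= Vx Vy z /andP[xz zy].
have [zx|zx] := leP `|z| `|x|; first exact: le_lt_trans (V_radial _ _ zx) Vx.
apply: le_lt_trans (V_radial _ _ _) Vy.
move: zx; have [x0|x0] := leP 0 x; have [z0|z0] := leP 0 z;
  have [y0|y0] := leP 0 y; rewrite ?(ger0_norm x0) ?(ltr0_norm x0) ?(ger0_norm z0)
  ?(ltr0_norm z0) ?(ger0_norm y0) ?(ltr0_norm y0); lra.
Qed.

Lemma measurable_antiradial {R : realType} (mu : R -> R) :
  radial (fun w => - mu w) ->
  measurable_fun [set: measurableTypeR R] (EFin \o mu).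
Proof.
move=> mu_radial.
rewrite (_ : _ \o _ = fun w => (- (- mu w)%:E)%E); last first.
  by apply/funext => w; rewrite -EFinN opprK.
apply: measurableT_comp => //; apply: measurable_radial => x y xy.
by rewrite lee_fin mu_radial.
Qed.

Lemma measurable_reflect {R : realType} (c : R) :
  measurable_fun [set: measurableTypeR R]
    (fun x : measurableTypeR R => c - x : measurableTypeR R).
Proof. exact: measurable_funB. Qed.

(** By uniqueness of Lebesgue measure it suffices to treat intervals []a, b]]; the preimage [[c - b,
    c - a[] is closed at the other end but has the same length. *)
Lemma lebesgue_measure_reflect {R : realType} (c : R) (A : set R) :
  measurable A ->
  pushforward lebesgue_measure (fun x : R => c - x : measurableTypeR R) A =
  lebesgue_measure A.
Proof.
pose refl : {mfun measurableTypeR R >-> measurableTypeR R} :=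
  HB.pack (fun x : measurableTypeR R => c - x : measurableTypeR R)
    (isMeasurableFun.Build _ _ _ _ _ (measurable_reflect c)).
move=> mA; apply/esym/(lebesgue_measure_unique
  (mu := pushforward lebesgue_measure refl)) => //= _ [[a b]] _ <-.
rewrite /pushforward.
rewrite (_ : _ @^-1` _ = `[c - b, c - a[%classic); last first.
  by apply/seteqP; split => x /=; rewrite !in_itv/=; lra.
rewrite !lebesgue_measure_itv/= !lte_fin ltrD2l ltrN2.
by case: ifP => // _; rewrite -!EFinB; congr EFin; ring.
Qed.

Lemma ge0_integral_reflect {R : realType} (c : R) (F : measurableTypeR R -> \bar R) :
  measurable_fun [set: measurableTypeR R] F -> (forall w, 0 <= F w)%E ->
  (\int[lebesgue_measure]_w F (c - w)%R = \int[lebesgue_measure]_w F w)%E.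
Proof.
move=> mF F0.
rewrite -[LHS](ge0_integral_pushforward (measurable_reflect c) lebesgue_measure
  measurableT mF (fun y _ => F0 y)).
apply: eq_measure_integral => /= [|mc A mA _]; first exact: measurable_reflect.
exact: lebesgue_measure_reflect.
Qed.

Lemma esum_reflect {R : realType} (c : int) (F : int -> \bar R) :
  (\esum_(w in [set: int]) F (c - w)%R = \esum_(w in [set: int]) F w)%E.
Proof.
apply/esym/reindex_esum; rewrite setTT_bijective.
by exists (fun w => c - w) => w; rewrite subKr.
Qed.

(** * Means of radial functions are radial in the shift *)

Lemma noise_mean_ge0 {R : realType} {X : alphabet} (mu : carrier R X -> R)
    (V : carrier R X -> \bar R) :
  (forall w, 0 <= mu w) -> (forall w, 0 <= V w)%E ->
  (0 <= noise_mean mu V)%E.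
Proof.
case: X mu V => /= mu V mu0 V0.
- by apply: esum_ge0 => w _; rewrite mule_ge0// lee_fin.
- by apply: integral_ge0 => w _; rewrite mule_ge0// lee_fin.
Qed.

(* Twice the mean at y is the mean of an integrand symmetrized by the reflection
   exchanging x and y, so the comparison of the means at x and y becomes
   pointwise. *)
Lemma mean_radial {R : realType} {A : realDomainType}
    (mean : (A -> \bar R) -> \bar R) (nice : (A -> \bar R) -> Prop)
    (mu : A -> R) (V : A -> \bar R) :
  (forall c F, nice F -> mean (fun w => F (c - w)) = mean F) ->
  (forall F G, nice F -> nice G ->
    mean (fun w => F w + G w)%E = (mean F + mean G)%E) ->
  (forall F G, nice F -> nice G -> (forall w, F w <= G w)%E ->
    (mean F <= mean G)%E) ->
  (forall c F, nice F -> nice (fun w => F (c - w))) ->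
  (forall F G, nice F -> nice G -> nice (fun w => F w + G w)%E) ->
  (forall x, nice (fun w => (mu w)%:E * V (x + w)%R)%E) ->
  (forall w, 0 <= mu w) -> (forall w, mu (- w) = mu w) ->
  radial (fun w => - mu w) -> (forall w, 0 <= V w)%E -> radial V ->
  radial (fun x => mean (fun w => (mu w)%:E * V (x + w)%R)%E).
Proof.
move=> mean_refl meanD le_mean nice_refl niceD nice_mu mu0 mu_even mu_radial
  V0 V_radial x y xy.
pose F x w := ((mu w)%:E * V (x + w)%R)%E.
change (mean (F x) <= mean (F y))%E.
have nF z : nice (F z) := nice_mu z.
have nFN z : nice (fun w => F z (0 - w)) by exact: nice_refl.
have twice_y : (mean (F y) + mean (F y) =
    mean (fun w => F y w + F y (x - y - w)%R))%E.
  by rewrite meanD ?mean_refl//; exact: (nice_refl (x - y) (F y)).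
(* The reflections are chosen so that both symmetrized integrands carry the weights [mu w],
   [mu (x - y - w)] and the values [V (y + w)], [V (x - w)], paired in opposite ways. *)
have twice_x : (mean (F x) + mean (F x) =
    mean (fun w => F x (0 - (x - y - w))%R + F x (0 - w)%R))%E.
  rewrite meanD//; last exact: (nice_refl (x - y) (fun w => F x (0 - w)%R)).
  by rewrite (mean_refl (x - y) (fun w => F x (0 - w)%R))// mean_refl.
(* Comparing doubles suffices, even with infinite means, because a strict inequality can be added to
   itself. *)
suff : (mean (F x) + mean (F x) <= mean (F y) + mean (F y))%E.
  by apply: contraLR; rewrite -!ltNge => lt_yx; exact: lteD.
rewrite twice_x twice_y.
apply: le_mean => [||w].
- exact: niceD (nice_refl (x - y) (fun w => F x (0 - w)%R) _) _.
- exact: niceD (nF y) (nice_refl (x - y) (F y) (nF y)).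
rewrite /F.
rewrite (_ : x + (0 - (x - y - w)) = y + w)%R; last by ring.
rewrite -(mu_even (0 - (x - y - w))%R) -(mu_even (0 - w)%R).
rewrite (_ : - (0 - (x - y - w)) = x - y - w)%R; last by ring.
rewrite (_ : - (0 - w) = w)%R; last by ring.
rewrite (_ : y + (x - y - w) = x - w)%R; last by ring.
rewrite (_ : x + (0 - w) = x - w)%R; last by ring.
(* Taken at [y + w], the dichotomy orders the two weights and the two values alike, so the integrand
   for [y] pairs larger with larger. *)
have := @reflection_dichotomy _ x y (y + w)%R xy.
rewrite (_ : y + w - y = w)%R; last by ring.
rewrite (_ : x + y - (y + w) = x - w)%R; last by ring.
rewrite (_ : y + w - x = - (x - y - w))%R ?normrN; last by ring.
move=> [[/mu_radial]|[/mu_radial]]; rewrite lerN2 => mule /V_radial Vle.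
  by rewrite rearrangement ?mu0 ?V0.
by rewrite addeC (addeC (_ * V (y + w)%R)%E) rearrangement ?mu0 ?V0.
Qed.

(** The abstract argument is instantiated with sums over the integers, for nonnegative functions,
    and with Lebesgue integrals, for nonnegative measurable ones. *)
Lemma noise_mean_radial {R : realType} {X : alphabet} (mu : carrier R X -> R)
    (V : carrier R X -> \bar R) :
  (forall w, 0 <= mu w) -> even_fun mu -> radial (fun w => - mu w) ->
  (forall w, 0 <= V w)%E -> radial V ->
  radial (fun x => noise_mean mu (fun w => V (x + w)%R)).
Proof.
case: X mu V => /= mu V mu0 mu_even mu_radial V0 V_radial.
- apply: (@mean_radial R int (fun F => \esum_(w in [set: int]) F w)%E
    (fun F => forall w, 0 <= F w)%E) => //.
  + by move=> c F _; exact: esum_reflect.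
  + by move=> F G F0 G0; rewrite esumD.
  + by move=> F G _ _ FG; exact: le_esum.
  + by move=> F G F0 G0 w; rewrite adde_ge0.
  + by move=> x w; rewrite mule_ge0 ?lee_fin.
- apply: (@mean_radial R R (fun F => \int[@lebesgue_measure R]_w F w)%E
    (fun F => measurable_fun [set: measurableTypeR R] F /\
              (forall w, 0 <= F w)%E)) => //.
  + by move=> c F [mF F0]; exact: ge0_integral_reflect.
  + by move=> F G [mF F0] [mG G0]; rewrite ge0_integralD.
  + by move=> F G [mF F0] [mG G0] FG; rewrite ge0_le_integral.
  + move=> c F [mF F0]; split => //.
    exact: (measurableT_comp mF (measurable_reflect c)).
  + move=> F G [mF F0] [mG G0]; split => [|w]; last by rewrite adde_ge0.
    exact: emeasurable_funD.
  + move=> x; split => [|w]; last by rewrite mule_ge0 ?lee_fin.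
    apply: emeasurable_funM; first exact: measurable_antiradial.
    apply: (@measurableT_comp _ _ _ (measurableTypeR R) (measurableTypeR R) _ V).
      exact: measurable_radial.
    exact: measurable_funD.
Qed.

(** * Continuity of means of radial functions *)

Lemma norm_segment {R : realDomainType} (x y z : R) :
  (x <= y <= z) || (z <= y <= x) -> `|y| <= `|x| \/ `|y| <= `|z|.
Proof.
by move=> /orP[] /andP[xy yz]; have [y0|y0] := leP 0 y; [right|left|left|right];
  rewrite ?(ger0_norm y0) ?(ltr0_norm y0) ler_normr; lra.
Qed.

(** For each rational [q], the set where [v < q] is centered at 0 with radius [r q] when bounded and
    nonempty. A jump of [v] at [x] straddles some rational [q], which forces [|x| = r q]. *)
Lemma radial_continuous {R : realType} (v : R -> R) : radial v ->
  exists2 D : set R, countable D & forall x, ~ D x -> v y @[y --> x] --> v x.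
Proof.
move=> v_radial.
pose S q := [set `|y| | y in [set y | v y < ratr q]].
pose r q := sup (S q).
exists (\bigcup_(q in [set: rat]) [set r q; - r q]) => [|x Dx].
  by apply: bigcup_countable => // q _; exact: finite_set_countable.
have {Dx} r_neq q : `|x| != r q.
  apply/eqP => xr; apply: Dx; exists q => //=; rewrite -xr.
  have [x0|x0] := leP 0 x; first by left; rewrite ger0_norm.
  by right; rewrite ltr0_norm// opprK.
apply/cvgrPdist_lt => e e0.
have [q1 /[!in_itv]/= /andP[vxq1 q1e]] : exists q, ratr q \in `]v x, v x + e[.
  by apply: rat_in_itvoo; rewrite ltrDl.
have [q2 /[!in_itv]/= /andP[eq2 q2vx]] : exists q, ratr q \in `]v x - e, v x[.
  by apply: rat_in_itvoo; rewrite gtrBl.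
(* Otherwise [|x|] would be the maximum of [S q1], hence equal to [r q1]. *)
have [z xz vz] : exists2 z, `|x| < `|z| & v z < ratr q1.
  apply: contrapT => no_z; move: (r_neq q1).
  have Sx : S q1 `|x| by exists x.
  have ub : ubound (S q1) `|x|.
    move=> _ [z vz <-]; rewrite leNgt; apply/negP => xz; apply: no_z.
    by exists z.
  move=> /eqP; apply; apply/eqP; rewrite eq_le ge_sup//; last by exists `|x|.
  by rewrite ub_le_sup//; exists `|x|.
have ub : ubound (S q2) `|x|.
  move=> _ [w vw <-]; rewrite leNgt; apply/negP => /ltW/v_radial.
  by rewrite leNgt (lt_trans vw).
have rx : r q2 < `|x|.
  rewrite lt_neqAle eq_sym r_neq/= /r.
  (* The supremum of the empty set is 0 by convention, which is still at most [|x|]. *)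
  have [->|S0] := eqVneq (S q2) set0; first by rewrite sup0.
  by apply: ge_sup => //; exact/set0P.
have near_lt : \forall y \near x, `|y| < `|z|.
  exact: (@cvgr_norm_lt R R R (nbhs x) _ id x cvg_id _ xz).
have near_gt : \forall y \near x, r q2 < `|y|.
  exact: (@cvgr_norm_gt R R R (nbhs x) _ id x cvg_id _ rx).
near=> y.
have vy1 : v y < ratr q1.
  by apply: le_lt_trans vz; apply: v_radial; apply: ltW; near: y.
have vy2 : ratr q2 <= v y.
  rewrite leNgt; apply/negP => vy.
  have : r q2 < `|y| by near: y.
  rewrite ltNge ub_le_sup//; first by exists `|x|.
  by exists y.
by rewrite ltr_distl; lra.
Unshelve. all: end_near. Qed.

(** Dominated convergence: [x_ k + w] lies between [l + w] and [b + w], so [v] there is at most the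
    sum of its values at these ends. Pointwise convergence fails only if [l + w] is one of countably
    many discontinuities. *)
Lemma radial_mean_cvg {R : realType} (mu v : R -> R) (x_ : nat -> R) (l b : R) :
  (forall w, 0 <= mu w) -> radial (fun w => - mu w) ->
  (forall w, 0 <= v w) -> radial v ->
  (forall k, (l <= x_ k <= b) || (b <= x_ k <= l)) -> x_ k @[k --> \oo] --> l ->
  (\int[lebesgue_measure]_w ((mu w)%:E * (v (l + w)%R)%:E) < +oo)%E ->
  (\int[lebesgue_measure]_w ((mu w)%:E * (v (b + w)%R)%:E) < +oo)%E ->
  (\int[lebesgue_measure]_w ((mu w)%:E * (v (x_ k + w)%R)%:E))%E @[k --> \oo] -->
  (\int[lebesgue_measure]_w ((mu w)%:E * (v (l + w)%R)%:E))%E.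
Proof.
move=> mu0 mu_radial v0 v_radial x_btw x_l int_l int_b.
have mv x : measurable_fun [set: measurableTypeR R]
    (fun w => (mu w)%:E * (v (x + w)%R)%:E)%E.
  apply: emeasurable_funM; first exact: measurable_antiradial.
  apply: (@measurableT_comp _ _ _ (measurableTypeR R) (measurableTypeR R) _
    (EFin \o v)); last exact: measurable_funD.
  by apply: measurable_radial => y z yz; rewrite lee_fin v_radial.
have integrable_v x : (\int[lebesgue_measure]_w ((mu w)%:E * (v (x + w)%R)%:E) < +oo)%E ->
    lebesgue_measure.-integrable [set: measurableTypeR R]
      (fun w => (mu w)%:E * (v (x + w)%R)%:E)%E.
  move=> int_x; apply/integrableP; split; first exact: mv.
  under eq_integral do rewrite gee0_abs ?mule_ge0 ?lee_fin//.
  exact: int_x.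
have [D D_count v_cont] := radial_continuous v_radial.
have D_null : \forall w \ae (@lebesgue_measure R), ~ D (l + w)%R.
  have shift_count : countable [set w | D (l + w)%R].
    apply: sub_countable D_count; apply: card_le_trans (card_image_le (fun y => y - l) D).
    apply: subset_card_le => w /= Dw; exists (l + w)%R => //.
    by rewrite addrAC subrr add0r.
  exists [set w | D (l + w)%R]; split => [||w /=]; last exact: contrapT.
    exact: countable_measurable.
  exact: countable_lebesgue_measure0.
have [|||_ _ //] := @dominated_convergence _ _ _ (@lebesgue_measure R) setT measurableT
  (fun k w => (mu w)%:E * (v (x_ k + w)%R)%:E)%E
  (fun w => (mu w)%:E * (v (l + w)%R)%:E)%E
  (fun w => (mu w)%:E * (v (l + w)%R)%:E + (mu w)%:E * (v (b + w)%R)%:E)%E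
  (fun k => mv (x_ k)) (mv l).
- have [N [mN N0 DN]] := D_null; exists N; split => // w; apply: contra_notP => Nw _.
  have {DN Nw} Dw : ~ D (l + w)%R by move=> Dw; apply: Nw; apply: DN => /=.
  apply: cvgeZl => //; apply: cvg_EFin.
    exact: nearW.
  apply: (@cvg_comp _ _ _ (fun k => x_ k + w)%R v _ (nbhs (l + w)%R)).
    by apply: cvgD => //; exact: cvg_cst.
  exact: v_cont.
- by apply: integrableD => //; exact: integrable_v.
- apply: aeW => w k _.
  rewrite gee0_abs ?mule_ge0 ?lee_fin//= -mulrDr ler_wpM2l//.
  have : (l + w <= x_ k + w <= b + w) || (b + w <= x_ k + w <= l + w).
    by rewrite !lerD2r.
  move=> /norm_segment[/v_radial le_l|/v_radial le_b].
    by rewrite (le_trans le_l)// lerDl.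
  by rewrite (le_trans le_b)// lerDr.
Qed.

(* X = Reals is a hypothesis rather than a specialization so that the conclusion
   applies to a model over an arbitrary alphabet. *)
Lemma right_approximation {R : realType} {X : alphabet} (e0 e1 : carrier R X) :
  X = Reals -> 0 <= e0 -> e0 < e1 ->
  exists e_ : nat -> carrier R X,
  [/\ forall k, e0 < e_ k <= e1,
    forall d : carrier R X -> R, right_continuous_nneg d ->
      d (e_ k) @[k --> \oo] --> d e0
    & forall (a : carrier R X) (mu : carrier R X -> R) (V : carrier R X -> \bar R),
      (forall w, 0 <= mu w) -> radial (fun w => - mu w) ->
      (forall w, 0 <= V w < +oo)%E -> radial V ->
      (forall e, noise_mean mu (fun w => V (a * e + w)%R) < +oo)%E ->
      noise_mean mu (fun w => V (a * e_ k + w)%R) @[k --> \oo] -->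
      noise_mean mu (fun w => V (a * e0 + w)%R)].
Proof.
move=> XR; subst X => /= e0_ge0 e01.
(* Since [harmonic k] is the inverse of [k + 1], the sequence starts at [e1] and stays strictly
   above [e0]. *)
pose e_ k : R := e0 + (e1 - e0) * harmonic k.
have e_cvg : e_ k @[k --> \oo] --> e0.
  rewrite -[X in _ --> X]addr0 -[X in e0 + X](mulr0 (e1 - e0)).
  by apply: cvgD; [exact: cvg_cst|apply: cvgMr; exact: cvg_harmonic].
have e_btw k : e0 < e_ k <= e1.
  have h_gt0 : 0 < (harmonic k : R) by exact: harmonic_gt0.
  have h_le1 : (harmonic k : R) <= 1 by rewrite /= invf_le1// ler1n.
  by rewrite /e_; apply/andP; split; nra.
exists e_; split => // [d d_rc|a mu V mu0 mu_radial V_fin V_radial int_V].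
  have /cvg_at_rightP d_seq := d_rc e0 e0_ge0.
  by apply: d_seq; split => // k; case/andP: (e_btw k).
pose v w := fine (V w).
have VE w : V w = (v w)%:E.
  by rewrite /v fineK// ge0_fin_numE; case/andP: (V_fin w).
have v_ge0 w : 0 <= v w by rewrite -lee_fin -VE; case/andP: (V_fin w).
have v_radial : radial v by move=> x y /V_radial; rewrite !VE lee_fin.
have meanE x : (\int[lebesgue_measure]_w ((mu w)%:E * V (a * x + w)%R))%E =
    (\int[lebesgue_measure]_w ((mu w)%:E * (v (a * x + w)%R)%:E))%E.
  by apply: eq_integral => w _; rewrite VE.
rewrite [X in _ --> X]meanE; under eq_fun do rewrite meanE.
(* The far end [a * e1] lies on either side of [a * e0], according to the sign of [a]. *)
apply: (@radial_mean_cvg _ _ _ _ _ (a * e1)) => // [k|||].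
- have /andP[/ltW e0_le e1_ge] := e_btw k.
  have [a0|a0] := leP 0 a; first by apply/orP; left; rewrite !ler_wpM2l.
  by apply/orP; right; rewrite !(ler_wnM2l (ltW a0)).
- by apply: cvgMr.
- by rewrite -meanE.
- by rewrite -meanE.
Qed.

(** The point [|x|] lies in the segment from [-|y|] to [|y|], at whose ends [d] takes the same
    value. *)
Lemma quasiconvex_even_radial {R : realType} {X : alphabet} (d : carrier R X -> R) :
  even_fun d -> quasiconvex d -> radial d.
Proof.
move=> d_even d_qc x y.
have d_norm z : d z = d `|z|.
  by have [z0|z0] := leP 0 z; [rewrite ger0_norm|rewrite ltr0_norm].
rewrite (d_norm x) (d_norm y) => xy.
have := d_qc (- `|y|) `|x| `|y|; rewrite d_even maxxx; apply => //.
by rewrite (le_trans _ (normr_ge0 x))// oppr_le0.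
Qed.

(** * Submodularity of the stage cost and monotonicity of the optimal power *)

Section Policy.
Context {R : realType} {X : alphabet} (a : carrier R X) (mu : carrier R X -> R).
Context {n : nat} (Q : 'M[R]_n) (m : nat) (u : nat -> R).
Context (p : 'I_n -> R -> R) (lam : R -> R) (d : carrier R X -> R) (T : nat).
Context (mu_ge0 : forall w, 0 <= mu w) (mu_even : even_fun mu)
  (mu_radial : radial (fun w => - mu w)).
Context (Q_ge0 : forall i j, 0 <= Q i j).
Context (u_incr : forall i j, (i < j)%N -> (j <= m)%N -> u i < u j).
Context (u0 : u 0%N = 0).
Context (p_prob : forall s i, (i <= m)%N -> 0 <= p s (u i) <= 1).
Context (p_power : forall s i j, (i <= j)%N -> (j <= m)%N -> p s (u j) <= p s (u i)).
Context (lam_ge0 : forall i, (i <= m)%N -> 0 <= lam (u i)).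
Context (d_ge0 : forall e, 0 <= d e) (d_radial : radial d).

Local Notation cost := (stage_cost a mu Q p lam d).
Local Notation value := (J a mu Q m u p lam d T).

Local Open Scope ereal_scope.

Section StageCost.
Context (V : carrier R X -> 'I_n -> \bar R).
Context (V_ge0 : forall e s, 0 <= V e s) (V_radial : forall s, radial (V^~ s)).

Let drop_mean_radial s x y : (`|x| <= `|y|)%R ->
  noise_mean mu (fun w => V (a * x + w)%R s) <=
  noise_mean mu (fun w => V (a * y + w)%R s).
Proof.
move=> xy.
have axy : (`|a * x| <= `|a * y|)%R by rewrite !normrM ler_wpM2l.
exact: (noise_mean_radial mu_ge0 mu_even mu_radial (V_ge0^~ s) (V_radial s) axy).
Qed.

Let mean_ge0 s (f : carrier R X -> carrier R X) :
  0 <= noise_mean mu (fun w => V (f w) s).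
Proof. by apply: noise_mean_ge0 => // w. Qed.

Let p_ge0 s i : (i <= m)%N -> 0 <= (p s (u i))%:E.
Proof. by move=> /(p_prob s)/andP[]; rewrite lee_fin. Qed.

Let receive_ge0 s i : (i <= m)%N -> 0 <= (1 - p s (u i))%:E.
Proof. by move=> /(p_prob s)/andP[]; rewrite lee_fin subr_ge0. Qed.

Let drop_prob_ge0 s i : (i <= m)%N -> (0 <= \sum_s' Q s s' * p s' (u i))%R.
Proof.
by move=> im; apply: sumr_ge0 => s' _; rewrite mulr_ge0// -lee_fin p_ge0.
Qed.

Lemma stage_cost_ge0 e s i : (i <= m)%N -> 0 <= cost V e s (u i).
Proof.
move=> im; rewrite /stage_cost !adde_ge0 ?lee_fin ?lam_ge0 ?mulr_ge0//.
  exact: drop_prob_ge0.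
apply: sume_ge0 => s' _; rewrite mule_ge0 ?lee_fin//.
by rewrite adde_ge0// mule_ge0 ?p_ge0 ?receive_ge0.
Qed.

Lemma stage_cost_radial s i : (i <= m)%N -> radial (fun e => cost V e s (u i)).
Proof.
move=> im x y xy; apply: leeD; first apply: leeD => //.
  by rewrite lee_fin ler_wpM2l ?drop_prob_ge0 ?d_radial.
apply: lee_sum => s' _; rewrite lee_wpmul2l ?lee_fin//.
by rewrite leeD// lee_wpmul2l ?p_ge0 ?drop_mean_radial.
Qed.

(** Only the distortion and the mean after a drop depend on the error. Both grow with its absolute
    value and are weighted by drop probabilities that decrease with the power, so each obeys the
    rearrangement inequality; the other terms agree on both sides. *)
Lemma stage_cost_submodular s i j x y :
  (i <= j)%N -> (j <= m)%N -> (`|x| <= `|y|)%R ->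
  cost V y s (u j) + cost V x s (u i) <= cost V y s (u i) + cost V x s (u j).
Proof.
move=> ij jm xy; have im := leq_trans ij jm.
rewrite /stage_cost addeACA [leRHS]addeACA; apply: leeD.
  rewrite addeACA [leRHS]addeACA [X in _ <= X + _]addeC; apply: leeD => //.
  rewrite !EFinM; apply: rearrangement.
    rewrite drop_prob_ge0//=; apply: ler_sum => s' _.
    by rewrite ler_wpM2l// p_power.
  by rewrite !lee_fin d_ge0 d_radial.
rewrite -!big_split; apply: lee_sum => s' _ /=.
have sum_ge0 e l : (l <= m)%N ->
    0 <= (p s' (u l))%:E * noise_mean mu (fun w => V (a * e + w)%R s')
      + (1 - p s' (u l))%:E * noise_mean mu (fun w => V w s').
  by move=> lm; rewrite adde_ge0// mule_ge0 ?p_ge0 ?receive_ge0.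
rewrite -!ge0_muleDr ?sum_ge0// lee_wpmul2l ?lee_fin//.
rewrite addeACA [leRHS]addeACA leeD//; last by rewrite addeC.
apply: rearrangement; first by rewrite p_power// -lee_fin p_ge0.
by rewrite mean_ge0 drop_mean_radial.
Qed.

(* Either the cost of u i at y is infinite and the claim is trivial, or the cost of
   u i at x is finite and can be cancelled from the submodular inequality. *)
Lemma higher_power_stays_better s i j x y :
  (i <= j)%N -> (j <= m)%N -> (`|x| <= `|y|)%R ->
  cost V x s (u j) <= cost V x s (u i) -> cost V y s (u j) <= cost V y s (u i).
Proof.
move=> ij jm xy cx; have im := leq_trans ij jm.
have [->|cy_fin] := eqVneq (cost V y s (u i)) +oo; first exact: leey.
have cx_fin : cost V x s (u i) \is a fin_num.
  rewrite ge0_fin_numE ?stage_cost_ge0//.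
  by rewrite (le_lt_trans (stage_cost_radial s im xy))// ltey.
rewrite -(leeD2rE _ _ cx_fin).
by rewrite (le_trans (stage_cost_submodular s ij jm xy))// leeD2l.
Qed.

End StageCost.

Lemma cost_to_go_ge0_radial k :
  (forall e s, 0 <= cost_to_go a mu Q m u p lam d k e s) /\
  (forall s, radial ((cost_to_go a mu Q m u p lam d k)^~ s)).
Proof.
elim: k => [|k [V_ge0 V_radial]] /=.
  by split => [e s|s x y _]; exact: lexx.
split => [e s|s x y xy].
  by apply/bigmin_geP; split => [|i _]; rewrite ?leey ?stage_cost_ge0// -ltnS.
by apply: le_bigmin2 => i _; apply: stage_cost_radial => //; rewrite -ltnS.
Qed.

Let value_ge0 t e s : 0 <= value t e s.
Proof. by have [+ _] := cost_to_go_ge0_radial (T.+1 - t); exact. Qed.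

Let value_radial t s : radial ((value t)^~ s).
Proof. by have [_] := cost_to_go_ge0_radial (T.+1 - t); exact. Qed.

Lemma valueE t e s : (t <= T)%N ->
  value t e s = \big[mine/+oo]_(i < m.+1) cost (value t.+1) e s (u i).
Proof. by move=> tT; rewrite /J (subSn tT). Qed.

Lemma value_le_cost t e s i : (t <= T)%N -> (i <= m)%N ->
  value t e s <= cost (value t.+1) e s (u i).
Proof.
move=> tT im; rewrite valueE//.
exact: (bigmin_le_cond _ (j := Ordinal (im : (i < m.+1)%N))).
Qed.

(** The optimal power is tracked through its index, characterized as the largest minimizer of the
    stage cost. *)
Definition is_policy_index t s e i :=
  [/\ (i <= m)%N, opt_power a mu Q m u p lam d T t e s = u i,
    forall l, (l <= m)%N -> cost (value t.+1) e s (u i) <= cost (value t.+1) e s (u l)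
    & forall j, (j <= m)%N ->
      (forall l, (l <= m)%N -> cost (value t.+1) e s (u j) <= cost (value t.+1) e s (u l)) ->
      (j <= i)%N].

Lemma u_le i j : (i <= j)%N -> (j <= m)%N -> (u i <= u j)%R.
Proof.
rewrite leq_eqVlt => /predU1P[->//|ij] jm; exact/ltW/u_incr.
Qed.

Lemma policy_index_exists t s e : (t <= T)%N -> exists i, is_policy_index t s e i.
Proof.
move=> tT; set c := fun i => cost (value t.+1) e s (u i).
have optP (i : 'I_m.+1) : c i == value t e s <-> forall l, (l <= m)%N -> c i <= c l.
  split => [/eqP-> l lm|c_min]; first exact: value_le_cost.
  rewrite eq_le value_le_cost //; last by rewrite -ltnS.
  rewrite andbT valueE//.
  by apply/bigmin_geP; split => [|l _]; rewrite ?leey// c_min// -ltnS.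
have [i0 _ i0P] : exists2 i0 : 'I_m.+1, true & c i0 == value t e s.
  have [i0 _ i0P] := @eq_bigmin _ _ 'I_m.+1 +oo ord0 predT (fun i => c i) isT
    (fun i _ => leey _).
  by exists i0 => //; rewrite valueE// i0P.
case: (@arg_maxnP _ i0 (fun i => c i == value t e s) (fun i => i) i0P) => i ci i_max.
exists i; split; first by rewrite -ltnS.
- apply/eqP; rewrite eq_le; apply/andP; split.
    (* The default 0 of the maximum is harmless because [u 0] is 0 and the levels increase. *)
    apply: bigmax_le => [|j cj]; first by rewrite -u0 u_le// -ltnS.
    by apply: u_le; [exact: i_max|rewrite -ltnS].
  exact: (le_bigmax_cond _ (fun i => u (nat_of_ord i)) ci).
- exact/optP.
- move=> j jm j_min.
  by apply: (i_max (Ordinal (jm : (j < m.+1)%N))); apply/optP.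
Qed.

(** If [j < i], then [u i], which is at least as good as [u j] at [x], stays so at [y]; [i] would
    then be a minimizer at [y] beyond the largest one. *)
Lemma policy_index_mono t s x y i j : (`|x| <= `|y|)%R ->
  is_policy_index t s x i -> is_policy_index t s y j -> (i <= j)%N.
Proof.
move=> xy [im _ i_min _] [jm _ j_min j_max].
rewrite leqNgt; apply/negP => ji.
have := j_max i im; rewrite leqNgt ji => /(_ _)/negP; apply => // l lm.
apply: le_trans (j_min l lm).
apply: (higher_power_stays_better (value_ge0 t.+1) (value_radial t.+1)
  (ltnW ji) im xy).
exact: i_min.
Qed.

(** * Attainment of thresholds over the reals *)

Lemma stage_cost_cvg V (e_ : nat -> carrier R X) e0 s i : (i <= m)%N ->
  (forall e s, 0 <= V e s) -> d (e_ k) @[k --> \oo] --> d e0 ->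
  (forall s', noise_mean mu (fun w => V (a * e_ k + w)%R s') @[k --> \oo] -->
    noise_mean mu (fun w => V (a * e0 + w)%R s')) ->
  (forall e s', noise_mean mu (fun w => V (a * e + w)%R s') < +oo) ->
  cost V (e_ k) s (u i) @[k --> \oo] --> cost V e0 s (u i).
Proof.
move=> im V_ge0 d_cvg mean_cvg mean_fin.
have mean_ge0 s' (f : carrier R X -> carrier R X) :
    0 <= noise_mean mu (fun w => V (f w) s') by apply: noise_mean_ge0 => // w.
have p_ge0 s' : 0 <= (p s' (u i))%:E by have /andP[] := p_prob s' im; rewrite lee_fin.
have q_ge0 s' : 0 <= (1 - p s' (u i))%:E.
  by have /andP[] := p_prob s' im; rewrite lee_fin subr_ge0.
have term_ge0 e s' : 0 <= (p s' (u i))%:E * noise_mean mu (fun w => V (a * e + w)%R s')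
    + (1 - p s' (u i))%:E * noise_mean mu (fun w => V w s').
  by rewrite adde_ge0// mule_ge0.
apply: cvgeD; first exact: fin_num_adde_defr.
  apply: cvgeD => //; first exact: cvg_cst.
  by apply: cvg_EFin; [exact: nearW|apply: cvgMr].
apply: cvg_nnesum => [s' _|s' _]; first by apply: nearW => k; rewrite mule_ge0 ?lee_fin.
apply: cvgeZl => //; apply: cvgeD; last exact: cvg_cst.
  by apply: ge0_adde_def; rewrite inE mule_ge0.
exact: cvgeZl.
Qed.

(** Let [j] be the smallest index used to the right of [e0]. By monotonicity it is used on a whole
    interval []e0, e1]], and a limit from the right makes it a minimizer at [e0], so [idx e0] is at
    least [j]. *)
Lemma policy_index_right_closed t s (idx : carrier R X -> nat) i e0 :
  X = Reals -> (t <= T)%N -> right_continuous_nneg d ->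
  (forall e s', value t.+1 e s' < +oo) ->
  (forall e s', noise_mean mu (fun w => value t.+1 (a * e + w)%R s') < +oo) ->
  (forall e, is_policy_index t s e (idx e)) -> (0 <= e0)%R ->
  (forall e, (e0 < e)%R -> (i <= idx e)%N) -> (i <= idx e0)%N.
Proof.
move=> XR tT d_rc value_fin mean_fin idxP e0_ge0 i_le.
pose used j := `[< exists2 e1, (e0 < e1)%R & idx e1 = j >].
have used_ex : exists j, used j.
  by exists (idx (e0 + 1)%R); apply/asboolP; exists (e0 + 1)%R; rewrite ?ltrDl.
have [j /asboolP[e1 e01 idx_e1] j_min] := ex_minnP used_ex.
have [e_ [e_btw d_cvg mean_cvg]] := right_approximation XR e0_ge0 e01.
have idx_e_ k : idx (e_ k) = j.
  have /andP[e0_lt e1_ge] := e_btw k.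
  apply/eqP; rewrite eqn_leq j_min ?andbT; last by apply/asboolP; exists (e_ k).
  rewrite -idx_e1; apply: policy_index_mono (idxP _) (idxP _).
  by rewrite !ger0_norm// ltW// (le_lt_trans e0_ge0).
have j_m : (j <= m)%N by have [+ _ _ _] := idxP e1; rewrite idx_e1.
apply: (@leq_trans j); first by rewrite -idx_e1 i_le.
have [_ _ _] := idxP e0; apply => // l lm.
(* Only the cost of [u l] is passed to the limit; the cost of [u j] at [e0] is bounded by its cost
   at [e_ k] through monotonicity. *)
apply: (@cvge_ge _ \oo _ _ (fun k => cost (value t.+1) (e_ k) s (u l))).
  apply: nearW => k; have [_ _ + _] := idxP (e_ k); rewrite idx_e_ => /(_ _ lm).
  apply: le_trans; apply: (stage_cost_radial (value_ge0 t.+1) (value_radial t.+1)) => //.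
  have /andP[/ltW e0_le _] := e_btw k.
  by rewrite !ger0_norm// (le_trans e0_ge0).
apply: stage_cost_cvg => // [|s']; first exact: d_cvg.
apply: (mean_cvg a mu ((value t.+1)^~ s') mu_ge0 mu_radial _
  (value_radial t.+1 s') (mean_fin^~ s')).
by move=> w; rewrite value_ge0 value_fin.
Qed.

(** The value is at most the cost of power 0, under which every packet is dropped, so that only
    means assumed finite occur. *)
Lemma value_lt_pinfty : (forall s, p s 0%R = 1%R) ->
  (forall t e s, (t <= T)%N ->
    noise_mean mu (fun w => value t.+1 (a * e + w)%R s) < +oo) ->
  forall t e s, value t e s < +oo.
Proof.
move=> p_zero mean_fin t e s; have [tT|Tt] := leqP t T; last first.
  by rewrite /J (_ : T.+1 - t = 0)%N; [exact: ltry|apply/eqP; rewrite subn_eq0].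
apply: le_lt_trans (value_le_cost e s tT (leq0n m)) _.
rewrite /stage_cost u0 !lte_add_pinfty ?ltry//.
apply: lte_sum_pinfty => s' _; rewrite lte_mul_pinfty ?lee_fin//.
by rewrite p_zero subrr mul1e mul0e adde0 mean_fin.
Qed.

End Policy.

(** * Thresholds as infima of upper level sets *)

Lemma ler_to_real {R : realType} {X : alphabet} (x y : carrier R X) :
  (to_real x <= to_real y) = (x <= y).
Proof. by case: X x y => x y //=; rewrite ler_int. Qed.

Lemma ltr_to_real {R : realType} {X : alphabet} (x y : carrier R X) :
  (to_real x < to_real y) = (x < y).
Proof. by rewrite !ltNge ler_to_real. Qed.

Lemma to_real0 {R : realType} {X : alphabet} : to_real (0 : carrier R X) = 0.
Proof. by case: X. Qed.

Section Threshold.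
Context {R : realType} {X : alphabet} (a : carrier R X) (mu : carrier R X -> R).
Context {n : nat} (Q : 'M[R]_n) (m : nat) (u : nat -> R).
Context (p : 'I_n -> R -> R) (lam : R -> R) (d : carrier R X -> R) (T : nat).
Context (t : nat) (s : 'I_n) (idx : carrier R X -> nat).
Context (u_incr : forall i j, (i < j)%N -> (j <= m)%N -> u i < u j).
Context (idx_le : forall e, (idx e <= m)%N)
  (idxE : forall e, opt_power a mu Q m u p lam d T t e s = u (idx e))
  (idx_mono : forall x y, `|x| <= `|y| -> (idx x <= idx y)%N).

Local Notation k := (threshold a mu Q m u p lam d T t s).

(** Unlike the level sets, these sets are nested in [i], so their infima are ordered. *)
Definition upper_level (i : nat) : set (\bar R) :=
  [set (to_real e)%:E | e in [set e | 0 <= e /\ (i <= idx e)%N]].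

Let level_setE i : (i <= m)%N -> level_set a mu Q m u p lam d T t s i =
  [set (to_real e)%:E | e in [set e | 0 <= e /\ idx e = i]].
Proof.
move=> im; congr image; apply/seteqP; split => e /= [e0]; rewrite idxE => ue.
  split => //; have [lt|gt|//] := ltngtP (idx e) i.
    by have := u_incr lt im; rewrite ue ltxx.
  by have := u_incr gt (idx_le e); rewrite ue ltxx.
by rewrite ue.
Qed.

Lemma thresholdE i : (i <= m.+1)%N -> k i = ereal_inf (upper_level i).
Proof.
rewrite /threshold; move r_eq : (m.+1 - i)%N => r im.
elim: r i im r_eq => [|r IH] i im r_eq /=.
  (* Here [i] is [m.+1], beyond every index, and the infimum of the empty set is [+oo]. *)
  rewrite (_ : upper_level i = set0) ?ereal_inf0//.
  rewrite -subset0 => y [e [_ ie] _].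
  by have := leq_trans ie (idx_le e); lia.
have im' : (i <= m)%N by lia.
rewrite level_setE//; case: asboolP => [[_ [e0 [e0_ge0 ie0] _]]|no_level].
  apply/eqP; rewrite eq_le; apply/andP; split; last first.
    apply: ereal_inf_le_tmp => _ [e [e_ge0 ie] <-].
    by exists e => //; split => //; rewrite ie.
  apply: le_ereal_inf_tmp => y [e [e_ge0]].
  rewrite leq_eqVlt => /predU1P[ie <-|ie <-].
    by apply: ereal_inf_lbound; exists e.
  apply: (@le_trans _ _ (to_real e0)%:E).
    by apply: ereal_inf_lbound; exists e0.
  rewrite lee_fin ler_to_real leNgt; apply/negP => /ltW ee0.
  have /idx_mono : `|e| <= `|e0| by rewrite !ger0_norm.
  by rewrite ie0 leqNgt ie.
rewrite IH; [|lia|lia]; congr ereal_inf; apply/seteqP; split => _ [e [e_ge0 ie] <-].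
  by exists e => //; split => //; exact: ltnW.
exists e => //; split => //.
rewrite ltn_neqAle ie andbT; apply/eqP => iE; apply: no_level.
by exists (to_real e)%:E, e.
Qed.

Lemma threshold0 : k 0%N = 0%E.
Proof.
rewrite thresholdE//; apply/eqP; rewrite eq_le; apply/andP; split.
  by apply: ereal_inf_lbound; exists 0 => //; rewrite to_real0.
apply: le_ereal_inf_tmp => _ [e [e_ge0 _] <-].
by rewrite lee_fin -(to_real0 (X := X)) ler_to_real.
Qed.

Lemma threshold_le i : (i <= m)%N -> (k i <= k i.+1)%E.
Proof.
move=> im; rewrite !thresholdE//; last exact: leqW.
apply: ereal_inf_le_tmp => _ [e [e_ge0 ie] <-].
by exists e => //; split => //; exact: ltnW.
Qed.

Lemma index_below_threshold i e : (i <= m)%N ->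
  ((to_real `|e|)%:E < k i.+1)%E -> (idx e <= i)%N.
Proof.
move=> im; rewrite thresholdE// ltNge; apply: contraR; rewrite -ltnNge => ie.
apply: ereal_inf_lbound; exists `|e| => //; split => //.
by rewrite (leq_trans ie)// idx_mono// normr_id.
Qed.

Lemma index_above_threshold i e : (i <= m)%N ->
  (k i < (to_real `|e|)%:E)%E -> (i <= idx e)%N.
Proof.
move=> im; rewrite thresholdE; last exact: leqW.
move=> /ereal_inf_lt[_ [e' [e'_ge0 ie'] <-]].
rewrite lte_fin ltr_to_real => /ltW e'e.
by rewrite (leq_trans ie')// idx_mono// ger0_norm.
Qed.

End Threshold.

(** If the index at [e] were below [i], every integer in the upper set would exceed [|e|], hence be
    at least [|e| + 1], and the infimum could not be [|e|]. *)
Lemma threshold_attained_int {R : realType} (a : int) (mu : int -> R)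
    n (Q : 'M[R]_n) m u p lam (d : int -> R) T t s (idx : int -> nat) i e :
  (forall i j, (i < j)%N -> (j <= m)%N -> u i < u j) ->
  (forall e, (idx e <= m)%N) ->
  (forall e, opt_power (X := Integers) a mu Q m u p lam d T t e s = u (idx e)) ->
  (forall x y, `|x| <= `|y| -> (idx x <= idx y)%N) ->
  (i <= m)%N ->
  threshold (X := Integers) a mu Q m u p lam d T t s i =
    (to_real (X := Integers) `|e|)%:E ->
  (i <= idx e)%N.
Proof.
move=> u_incr idx_le idxE idx_mono im.
rewrite (thresholdE (X := Integers) u_incr idx_le idxE idx_mono); last exact: leqW.
move=> inf_e; rewrite leqNgt; apply/negP => ie.
suff : ((to_real (X := Integers) (`|e| + 1))%:E <= (to_real (X := Integers) `|e|)%:E :> \bar R)%E.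
  by rewrite lee_fin ler_to_real gerDl.
rewrite -[leRHS]inf_e; apply: le_ereal_inf_tmp => _ [e' [e'_ge0 ie'] <-].
rewrite lee_fin ler_to_real -ltzD1 ltrD2r ltNge; apply/negP => e'e.
have /idx_mono : `|e'| <= `|e| by rewrite (ger0_norm e'_ge0).
by rewrite leqNgt (leq_trans ie).
Qed.

(** * The threshold form of the optimal strategy *)

Unset Implicit Arguments.

Theorem corollary1 (R : realType) (X : alphabet)
    (a : carrier R X) (mu : carrier R X -> R)
    (n : nat) (Q : 'M[R]_n) (m : nat) (u : nat -> R)
    (p : 'I_n -> R -> R) (lam : R -> R) (d : carrier R X -> R) (T : nat)
    (mu_distr : is_distribution mu)
    (mu_even : even_fun mu)
    (mu_unimodal : unimodal mu)
    (Q_trans : transition_matrix Q)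
    (Q_mono : stochastically_monotone Q)
    (u0 : u 0%N = 0)
    (u_incr : forall i j, (i < j)%N -> (j <= m)%N -> u i < u j)
    (p_prob : forall s i, (i <= m)%N -> 0 <= p s (u i) <= 1)
    (p_zero : forall s, p s 0 = 1)
    (p_power : forall s i j, (i <= j)%N -> (j <= m)%N -> p s (u j) <= p s (u i))
    (p_state : forall (s s' : 'I_n) i, (s <= s')%N -> (i <= m)%N ->
       p s' (u i) <= p s (u i))
    (lam_zero : lam 0 = 0)
    (lam_incr : forall i j, (i <= j)%N -> (j <= m)%N -> lam (u i) <= lam (u j))
    (d_zero : d 0 = 0)
    (d_even : even_fun d)
    (d_qconvex : quasiconvex d)
    (t : nat) (t_le : (t <= T)%N) (s : 'I_n) :
  let f := opt_power a mu Q m u p lam d T t in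
  let k := threshold a mu Q m u p lam d T t s in
  [/\ k 0%N = 0%E,
      forall i, (i <= m)%N -> (k i <= k i.+1)%E &
      forall (i : nat) (e : carrier R X), (i <= m)%N ->
        (k i <= (to_real `|e|)%:E < k i.+1)%E ->
        boundary_regular a mu Q m u p lam d T \/ (k i < (to_real `|e|)%:E)%E ->
        f e s = u i].
Proof.
move=> f k; have [mu_ge0 _] := mu_distr; have [Q_ge0 _] := Q_trans.
have mu_radial := unimodal_even_radial mu_even mu_unimodal.
have d_radial := quasiconvex_even_radial d_even d_qconvex.
have d_ge0 e : 0 <= d e by rewrite -d_zero d_radial// normr0.
have lam_ge0 i : (i <= m)%N -> 0 <= lam (u i).
  by move=> im; rewrite -lam_zero -u0 lam_incr.
have [idx idxP] := choice (fun e =>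
  policy_index_exists a mu Q p lam d u_incr u0 s e t_le).
have idx_le e : (idx e <= m)%N by have [] := idxP e.
have idxE e : f e s = u (idx e) by have [] := idxP e.
have idx_mono x y : `|x| <= `|y| -> (idx x <= idx y)%N.
  by move=> xy; apply: policy_index_mono (idxP x) (idxP y).
split; first exact: threshold0 u_incr idx_le idxE idx_mono.
  exact: threshold_le u_incr idx_le idxE idx_mono.
move=> i e im /andP[ke ek] regular.
have idx_abs x : idx `|x| = idx x by apply/eqP; rewrite eqn_leq !idx_mono ?normr_id.
suff idx_ge : (i <= idx e)%N.
  rewrite idxE; congr u; apply/eqP; rewrite eqn_leq idx_ge andbT.
  exact: index_below_threshold u_incr idx_le idxE idx_mono _ _ im ek.
have above x : (k i < (to_real `|x|)%:E)%E -> (i <= idx x)%N.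
  exact: index_above_threshold u_incr idx_le idxE idx_mono _ _ im.
case: regular => [regular|]; last exact: above.
(* Only the boundary case, where [|e|] equals the threshold, needs regularity. *)
move: ke; rewrite le_eqVlt => /predU1P[ke|]; last exact: above.
have [XE|XR] : X = Integers \/ X = Reals by case: (X); [left|right].
  subst X; exact: threshold_attained_int u_incr idx_le idxE idx_mono im ke.
case: regular => [XE|[d_rc mean_fin]]; first by rewrite XE in XR.
(* Right-closedness concerns nonnegative points, so [e] is replaced by [|e|]; every larger point
   lies strictly above the threshold. *)
rewrite -idx_abs.
apply: (policy_index_right_closed mu_ge0 mu_even mu_radial Q_ge0 p_prob
  p_power lam_ge0 d_ge0 d_radial XR t_le d_rc _ _ idxP) => // [x s'|x s'|x ex].
- exact: (value_lt_pinfty Q_ge0 u0 p_zero mean_fin).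
- exact: mean_fin.
- apply: above; rewrite ke lte_fin ltr_to_real (ger0_norm (x := x))//.
  by rewrite ltW// (le_lt_trans _ ex).
Qed.
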